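(* Let $k\geq 1$ and $n\geq 2k+2$ be integers and let $G$ be a $C_{4}$-free $k$-cyclic graph of order $n$. Then $$q(G)\leq q(G_{n}^{k}),$$ with equality if and only if $G=G_{n}^{k}$ (up to isomorphism), where $q(G_{n}^{k})$ is the largest root of the equation $$x^{3}-(n+3)x^{2}+3nx-4k=0.$$
   Context: All graphs are finite and simple. A $k$-cyclic graph is a connected graph of order $n$ (number of vertices) and size $n+k-1$ (number of edges). A graph is $C_4$-free if it has no (not necessarily induced) subgraph isomorphic to the cycle $C_4$ on 4 vertices. For a graph $G$ with adjacency matrix $A(G)$ and diagonal matrix of vertex degrees $D(G)$, the signless Laplacian matrix is $Q(G)=D(G)+A(G)$, and $q(G)$ denotes the largest eigenvalue of $Q(G)$ (the signless Laplacian spectral radius). The graph $G_n^k=K_1\vee(kK_2\cup(n-2k-1)K_1)$ is the join of a single vertex with the disjoint union of $k$ copies of $K_2$ and $n-2k-1$ isolated vertices; that is, $k$ triangles sharing one common vertex, together with $n-2k-1$ pendant vertices attached to that common vertex. *)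

(* Defs.v *)
From mathcomp Require Import all_boot all_order all_algebra.
From mathcomp Require Import classical_sets reals.
From mathcomp Require Import complex polyrcf.

Set Implicit Arguments.
Unset Strict Implicit.
Unset Printing Implicit Defensive.

Import Order.TTheory GRing.Theory Num.Theory.
Local Open Scope ring_scope.
Local Open Scope sesquilinear_scope.

(** * Finite simple graphs *)

Record sgraph := SGraph {
  svertex :> finType;
  sedge : rel svertex;
  sedge_sym : symmetric sedge;
  sedge_irrefl : irreflexive sedge }.

Notation "x -- y" := (sedge x y) (at level 30).

Definition edges (G : sgraph) : {set {set G}} :=
  [set [set p.1; p.2] | p : G * G & p.1 -- p.2].

Definition gorder (G : sgraph) : nat := #|G|.

Definition gsize (G : sgraph) : nat := #|edges G|.

Definition deg (G : sgraph) (x : G) : nat := #|[set y | x -- y]|.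

Definition gconnected (G : sgraph) : Prop :=
  forall x y : G, connect (@sedge G) x y.

(* The size is the order plus k - 1; no truncated subtraction when k = 0. *)
Definition cyclic_graph (k : nat) (G : sgraph) : Prop :=
  gconnected G /\ (gsize G + 1 = gorder G + k)%N.

Definition isomorphic (G H : sgraph) : Prop :=
  exists2 f : G -> H, bijective f & {mono f : x y / x -- y}.

(* H occurs in G as a (not necessarily induced) subgraph. *)
Definition has_subgraph (G H : sgraph) : Prop :=
  exists2 f : H -> G, injective f & {homo f : x y / x -- y}.

(** ** Constructions *)

Definition complete_rel (m : nat) : rel 'I_m := fun i j => i != j.

Lemma complete_sym m : symmetric (@complete_rel m).
Proof. by move=> i j; rewrite /complete_rel eq_sym. Qed.

Lemma complete_irrefl m : irreflexive (@complete_rel m).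
Proof. by move=> i; rewrite /complete_rel eqxx. Qed.

Definition complete (m : nat) : sgraph :=
  SGraph (@complete_sym m) (@complete_irrefl m).

Definition C4_rel : rel 'I_4 := fun i j => (j == ordS i) || (i == ordS j).

Lemma C4_sym : symmetric C4_rel.
Proof. by move=> i j; rewrite /C4_rel orbC. Qed.

Lemma C4_irrefl : irreflexive C4_rel.
Proof. by case=> [[|[|[|[|]]]]]. Qed.

Definition C4 : sgraph := SGraph C4_sym C4_irrefl.

Definition C4_free (G : sgraph) : Prop := ~ has_subgraph G C4.

(* [b] tells whether vertices of different summands are adjacent. *)
Definition sum_rel (b : bool) (G H : sgraph) : rel (G + H) := fun u v =>
  match u, v with
  | inl x, inl y => x -- y
  | inr x, inr y => x -- y
  | _, _ => b
  end.
Arguments sum_rel : clear implicits.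

Lemma sum_sym b G H : symmetric (sum_rel b G H).
Proof. by move=> [x|x] [y|y] //=; exact: sedge_sym. Qed.

Lemma sum_irrefl b G H : irreflexive (sum_rel b G H).
Proof. by move=> [x|x] /=; exact: sedge_irrefl. Qed.

Definition disjoint_union (G H : sgraph) : sgraph :=
  SGraph (@sum_sym false G H) (@sum_irrefl false G H).

Definition gjoin (G H : sgraph) : sgraph :=
  SGraph (@sum_sym true G H) (@sum_irrefl true G H).

Definition copies_rel (m : nat) (G : sgraph) : rel ('I_m * G) := fun u v =>
  (u.1 == v.1) && u.2 -- v.2.
Arguments copies_rel : clear implicits.

Lemma copies_sym m G : symmetric (copies_rel m G).
Proof. by move=> u v; rewrite /copies_rel eq_sym sedge_sym. Qed.

Lemma copies_irrefl m G : irreflexive (copies_rel m G).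
Proof. by move=> u; rewrite /copies_rel sedge_irrefl andbF. Qed.

Definition copies (m : nat) (G : sgraph) : sgraph :=
  SGraph (@copies_sym m G) (@copies_irrefl m G).

(* K_1 v (k K_2 u (n - 2k - 1) K_1); it has order n when 2k + 1 <= n. *)
Definition Gnk (n k : nat) : sgraph :=
  gjoin (complete 1)
       (disjoint_union (copies k (complete 2))
                       (copies (n - 2 * k - 1) (complete 1))).

(** * Signless Laplacian *)

Definition largest (R : realType) (P : R -> Prop) (x : R) : Prop :=
  P x /\ forall y, P y -> y <= x.

Definition adjacency (R : realType) (G : sgraph) : 'M[R]_#|G| :=
  \matrix_(i, j) (enum_val i -- enum_val j)%:R.

Definition degree_mx (R : realType) (G : sgraph) : 'M[R]_#|G| :=
  diag_mx (\row_i (deg (enum_val i))%:R).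

Definition signless_laplacian (R : realType) (G : sgraph) : 'M[R]_#|G| :=
  degree_mx R G + adjacency R G.

(* The supremum is attained as soon as G has a vertex: see [signless_radius_largest]. *)
Definition signless_radius (R : realType) (G : sgraph) : R :=
  sup [set x : R | eigenvalue (signless_laplacian R G) x]%classic.

Lemma signless_laplacian_sym (R : realType) (G : sgraph) :
  (signless_laplacian R G)^T = signless_laplacian R G.
Proof.
rewrite /signless_laplacian raddfD /= tr_diag_mx; congr (_ + _).
by apply/matrixP => i j; rewrite !mxE sedge_sym.
Qed.

Lemma symmetric_eigenvalue (R : realType) n (A : 'M[R]_n) :
  (0 < n)%N -> A^T = A -> exists a, eigenvalue A a.
Proof.
move=> n0 symA; pose f : {rmorphism R -> R[i]%C} := real_complex R.
have [c Ac] := eigenvalue_closed (map_mx f A) n0.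
have [v vA v0] := eigenvalueP Ac.
have BC : (map_mx f A)^t* = map_mx f A.
  apply/matrixP => i j; rewrite !mxE /=; apply: etrans (conjc_real _) _.
  by rewrite -[in RHS]symA mxE.
have d0 : dotmx v v != 0 by rewrite dnorm_eq0.
have E : c^* * dotmx v v = c * dotmx v v.
  rewrite !dotmxE.
  have -> : c * (v *m v^t*) 0 0 = (v *m map_mx f A *m v^t*) 0 0.
    by rewrite vA -scalemxAl [RHS]mxE.
  have -> : c^* * (v *m v^t*) 0 0 = (v *m (v *m map_mx f A)^t*) 0 0.
    by rewrite vA linearZ /= map_mxZ -scalemxAr [RHS]mxE.
  by rewrite trmx_mul map_mxM BC mulmxA.
have /CrealP/complex_realP[a ca] : c^* = c by exact: (mulIf d0 E).
exists a; move: Ac; rewrite !eigenvalue_root_char ca.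
by rewrite -map_char_poly fmorph_root.
Qed.

Lemma signless_radius_largest (R : realType) (G : sgraph) : (0 < #|G|)%N ->
  largest (eigenvalue (signless_laplacian R G)) (signless_radius R G).
Proof.
move=> G0; rewrite /signless_radius; set A := signless_laplacian R G.
have [a Aa] := symmetric_eigenvalue G0 (signless_laplacian_sym R G).
have p0 : char_poly A != 0 by rewrite monic_neq0 ?char_poly_monic.
have rE x : (x \in rootsR (char_poly A)) = eigenvalue A x.
  by rewrite -roots_on_rootsR // eigenvalue_root_char.
have [m Am mP] : exists2 m, eigenvalue A m & forall y, eigenvalue A y -> y <= m.
  exists (\big[Num.max/a]_(x <- rootsR (char_poly A)) x) => [|y].
    rewrite big_seq; elim/big_ind: _ => [//|x y Ax Ay|x]; last by rewrite rE.
    by rewrite maxEle; case: ifP.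
  by rewrite -rE => yr; apply: (bigmax_sup_seq _ y).
suff -> : sup [set x : R | eigenvalue A x]%classic = m by split.
apply/eqP; rewrite eq_le; apply/andP; split.
  by apply: ge_sup; [exists m | move=> y /mP].
by apply: ub_le_sup => //; exists m => y /mP.
Qed.

(* Main.v *)
(** A positive function x on the vertices with
    sum_{w ~ u} (x u + x w) <= m * x u for all u certifies q(G) <= m, and
    equality everywhere forces q(G) = m. For G_n^k the function with values 1,
    1/(q-3), 1/(q-1) on the centre, the triangles and the pendant vertices
    identifies q(G_n^k) with the root q > n of x(x-3)(x-n) = 4k.

    If G has a dominating vertex c, then C_4-freeness makes the neighbourhood
    of c a matching, with k edges by counting, so G is G_n^k. Otherwise
    q(G) <= n < q(G_n^k): the degree function is a certificate, because two
    distinct vertices have at most one common neighbour, except possibly when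
    some c has even degree n - 2; then a modified function is used for n >= 6,
    and the constant one for n = 4. *)

Require Import Defs.
From mathcomp Require Import all_boot all_order all_algebra.
From mathcomp Require Import reals.
From mathcomp Require Import zify ring lra.

Import Order.TTheory GRing.Theory Num.Theory.
Local Open Scope ring_scope.

(** * Eigenvectors as functions on the vertices, and positive certificates *)

Lemma signless_laplacian_action (R : realType) (G : sgraph) (v : 'rV[R]_#|G|)
    (x : G -> R) (u : G) :
  (forall w, x w = v 0 (enum_rank w)) ->
  (v *m signless_laplacian R G) 0 (enum_rank u) =
    \sum_(w | u -- w) (x u + x w).
Proof.
move=> vE; rewrite /signless_laplacian mulmxDr mxE big_split /=; congr (_ + _).
  rewrite mul_mx_diag !mxE enum_rankK -vE sumr_const mulr_natr.
  by congr (_ *+ _); apply: eq_card => w; rewrite inE.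
rewrite !mxE (reindex enum_rank) /=; last first.
  by exists enum_val => i _; rewrite ?enum_rankK ?enum_valK.
rewrite [RHS]big_mkcond /=; apply: eq_bigr => w _.
by rewrite !mxE !enum_rankK -vE sedge_sym; case: ifP; rewrite ?mulr1 ?mulr0.
Qed.

(** In this form an eigenvector can be given by cases on the vertices and transported along a
    bijection, without going through [enum_rank]. *)
Lemma signless_eigenvalueP (R : realType) (G : sgraph) (a : R) :
  eigenvalue (signless_laplacian R G) a <->
  exists2 x : G -> R, exists u, x u != 0 &
    forall u, \sum_(w | u -- w) (x u + x w) = a * x u.
Proof.
split=> [/eigenvalueP[v vQ v0]|[x [u0 xu0] xP]].
  exists (fun u => v 0 (enum_rank u)).
    have /rV0Pn[i vi0] := v0.
    by exists (enum_val i); rewrite enum_valK.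
  move=> u; rewrite -(signless_laplacian_action _ _ v) // vQ mxE //.
pose v : 'rV[R]_#|G| := \row_i x (enum_val i).
have vE w : x w = v 0 (enum_rank w) by rewrite mxE enum_rankK.
apply/eigenvalueP; exists v; last first.
  by apply/rV0Pn; exists (enum_rank u0); rewrite -vE.
apply/rowP => i; rewrite -(enum_valK i) (signless_laplacian_action _ _ _ x) //.
by rewrite xP mxE -vE.
Qed.

(** Collatz-Wielandt argument: for an eigenvector $y$ of $q$, let $M$ be the maximum of $|y_u|/x_u$,
    attained at $u$. Then $|y| \leq Mx$ with equality at $u$, and the triangle inequality in the
    eigenvalue equation at $u$ gives $q M x_u \leq a M x_u$. *)
Lemma signless_radius_le (R : realType) (G : sgraph) (x : G -> R) (a : R) :
  (0 < #|G|)%N -> (forall u, 0 < x u) ->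
  (forall u, \sum_(w | u -- w) (x u + x w) <= a * x u) ->
  signless_radius R G <= a.
Proof.
move=> G0 x0 xa.
have [/signless_eigenvalueP[y [u0 yu0] yP] _] := signless_radius_largest R G0.
set q := signless_radius R G in yP *.
case: (@arg_maxP _ _ _ u0 xpredT (fun u => `|y u| / x u)) => // u _ uP.
set M := `|y u| / x u in uP.
have yM w : `|y w| <= M * x w by rewrite -ler_pdivrMr //; exact: uP.
have M0 : 0 < M.
  by apply: lt_le_trans (uP u0 isT); rewrite divr_gt0 ?normr_gt0.
have yu : `|y u| = M * x u by rewrite /M divfK ?gt_eqF.
have Mx : 0 < M * x u by rewrite mulr_gt0.
suff : q * (M * x u) <= a * (M * x u) by rewrite ler_pM2r.
rewrite -[X in q * X]yu.
(* Only $q \leq |q|$ is used here, in place of a sign for $q$. *)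
apply: (@le_trans _ _ `|q * y u|).
  by rewrite normrM ler_wpM2r ?ler_norm.
rewrite -yP; apply: le_trans (ler_norm_sum _ _ _) _.
apply: (@le_trans _ _ (\sum_(w | u -- w) M * (x u + x w))).
  by apply: ler_sum => w _; rewrite mulrDr (le_trans (ler_normD _ _)) ?lerD.
by rewrite -mulr_sumr mulrCA ler_pM2l.
Qed.

Lemma signless_radius_eq (R : realType) (G : sgraph) (x : G -> R) (a : R) :
  (0 < #|G|)%N -> (forall u, 0 < x u) ->
  (forall u, \sum_(w | u -- w) (x u + x w) = a * x u) ->
  signless_radius R G = a.
Proof.
move=> G0 x0 xa; apply/eqP; rewrite eq_le.
have [_ qmax] := signless_radius_largest R G0.
apply/andP; split; first by apply: signless_radius_le x0 _ => // u; rewrite xa.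
apply: qmax; apply/signless_eigenvalueP; exists x => //.
by have /card_gt0P[u _] := G0; exists u; rewrite gt_eqF.
Qed.

(** * Invariance under isomorphism, and certificates with natural values *)

Lemma isomorphic_eigenvalue (R : realType) (G H : sgraph) (a : R) :
  isomorphic G H -> eigenvalue (signless_laplacian R H) a ->
  eigenvalue (signless_laplacian R G) a.
Proof.
move=> [f [g fK gK] fE] /signless_eigenvalueP[x [u xu] xP].
apply/signless_eigenvalueP; exists (x \o f); first by exists (g u); rewrite /= gK.
move=> v; rewrite /= -xP [RHS](reindex f) /=; last by exists g => w _.
by apply: eq_bigl => w; rewrite fE.
Qed.

Lemma isomorphic_sym (G H : sgraph) : isomorphic G H -> isomorphic H G.
Proof.
move=> [f [g fK gK] fE]; exists g; first by exists f.
by move=> x y; rewrite -fE !gK.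
Qed.

Lemma isomorphic_signless_radius (R : realType) (G H : sgraph) :
  (0 < #|G|)%N -> isomorphic G H -> signless_radius R G = signless_radius R H.
Proof.
move=> G0 GH; have [f fb _] := GH.
have H0 : (0 < #|H|)%N by rewrite -(bij_eq_card fb).
have [Gq Gmax] := signless_radius_largest R G0.
have [Hq Hmax] := signless_radius_largest R H0.
apply/eqP; rewrite eq_le; apply/andP; split.
  exact: Hmax _ (isomorphic_eigenvalue R H G _ (isomorphic_sym _ _ GH) Gq).
exact: Gmax _ (isomorphic_eigenvalue R G H _ GH Hq).
Qed.

(** Natural values keep the certificate inequalities within reach of [lia] and [nia]. *)
Lemma signless_radius_le_nat (R : realType) (G : sgraph) (x : G -> nat) (m : nat) :
  (0 < #|G|)%N -> (forall u, 0 < x u)%N ->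
  (forall u, \sum_(w | u -- w) (x u + x w) <= m * x u)%N ->
  signless_radius R G <= m%:R.
Proof.
move=> G0 x0 xm; apply: (signless_radius_le _ _ (fun u => (x u)%:R)) => // u.
  by rewrite ltr0n.
by under eq_bigr do rewrite -natrD; rewrite -natr_sum -natrM ler_nat.
Qed.

(** * The spectral radius of $G_n^k$ *)

Lemma Gnk_gt0 n k : (0 < #|Gnk n k|)%N.
Proof. by apply/card_gt0P; exists (inl ord0). Qed.

Definition Gnk_vector (R : realType) (n k : nat) (a : R) (u : Gnk n k) : R :=
  match u with
  | inl _ => 1
  | inr (inl _) => (a - 3)^-1
  | inr (inr _) => (a - 1)^-1
  end.

(** With value 1 at the centre, a triangle vertex requires $3x + 1 = ax$ and a pendant vertex $x + 1
    = ax$, which dictates the values. The equation left at the centre is the cubic after clearing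
    denominators. *)
Lemma Gnk_vectorP (R : realType) (n k : nat) (a : R) (u : Gnk n k) :
  (2 * k < n)%N -> 3 < a ->
  a ^+ 3 - (n + 3)%:R * a ^+ 2 + (3 * n)%:R * a - (4 * k)%:R = 0 ->
  \sum_(w | u -- w) (Gnk_vector R n k a u + Gnk_vector R n k a w) =
    a * Gnk_vector R n k a u.
Proof.
move=> kn a3 aP.
have a3' : a - 3 != 0 by rewrite subr_eq0 gt_eqF.
have a1 : a - 1 != 0 by apply/eqP; lra.
rewrite big_mkcond big_sumType /= big_ord1 big_sumType /=.
case: u => [i|[[i e]|[i e]]] /=.
- have -> : complete_rel i ord0 = false by apply/eqP; rewrite (ord1 i).
  rewrite add0r !sumr_const !card_prod !card_ord.
  have -> : (n - 2 * k - 1)%N = (n - (2 * k + 1))%N by lia.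
  rewrite muln1 -[X in X + _ = _]mulr_natr -[X in _ + X = _]mulr_natr natrB; last by lia.
  (* The two sides of the equation at the centre differ by minus the cubic over $(a-3)(a-1)$. *)
  apply/subr0_eq; transitivity (- (a ^+ 3 - (n + 3)%:R * a ^+ 2 + (3 * n)%:R * a
     - (4 * k)%:R) / ((a - 3) * (a - 1))); last by rewrite aP oppr0 mul0r.
  by rewrite !natrD !natrM; field; rewrite a3' a1.
- rewrite [X in _ + (_ + X)]big1 // addr0.
  (* [rev_ord] swaps the two elements of ['I_2], so this is the other non-central vertex of the
     triangle. *)
  rewrite (bigD1 (i, rev_ord e)) //= big1 ?addr0; last first.
    move=> [j e'] /=; rewrite /copies_rel /= /complete_rel xpair_eqE.
    case: (i =P j) => [->|//]; rewrite eqxx /=.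
    by case: e e' => [[|[|]]] // ? [[|[|]]].
  rewrite /copies_rel /= /complete_rel eqxx.
  have -> : e != rev_ord e by case: e => [[|[|]]].
  by rewrite /=; field.
- rewrite [X in _ + (X + _)]big1 // add0r big1 ?addr0.
    by field.
  by move=> [j e'] _; rewrite /copies_rel /= /complete_rel !ord1 eqxx andbF.
Qed.

Lemma Gnk_cubic_factor (R : realType) (n k : nat) (x : R) :
  x ^+ 3 - (n + 3)%:R * x ^+ 2 + (3 * n)%:R * x - (4 * k)%:R =
  x * (x - 3) * (x - n%:R) - (4 * k)%:R.
Proof. by rewrite natrD !natrM; ring. Qed.

Lemma Gnk_cubic_root (R : realType) (n k : nat) (a : R) :
  (2 < n)%N -> (2 * k < n)%N -> n%:R < a ->
  a ^+ 3 - (n + 3)%:R * a ^+ 2 + (3 * n)%:R * a - (4 * k)%:R = 0 ->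
  signless_radius R (Gnk n k) = a.
Proof.
move=> n2 kn na aP; have a3 : 3 < a by apply: le_lt_trans na; rewrite ler_nat.
apply: signless_radius_eq (Gnk_gt0 n k) _ (fun u => Gnk_vectorP R n k a u kn a3 aP).
by case=> [?|[?|?]] /=; rewrite ?invr_gt0; lra.
Qed.

(** The cubic is $-4k$ at $n$ and $(n+1)(n-2) - 4k \geq 0$ at $n+1$, so it has a root in $(n, n+1]$.
    By [Gnk_cubic_root] every root above $n$ equals the spectral radius, so this root is the only
    one there and hence the largest. *)
Lemma Gnk_radius (R : realType) (n k : nat) : (1 <= k)%N -> (2 * k + 2 <= n)%N ->
  n%:R < signless_radius R (Gnk n k) /\
  largest (fun x : R => x ^+ 3 - (n + 3)%:R * x ^+ 2 + (3 * n)%:R * x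
                          - (4 * k)%:R = 0) (signless_radius R (Gnk n k)).
Proof.
move=> k1 kn; have n2 : (2 < n)%N by lia. have kn' : (2 * k < n)%N by lia.
pose p : {poly R} := 'X * ('X - 3%:P) * ('X - n%:R%:P) - (4 * k)%:R%:P.
have pE x : p.[x] = x * (x - 3) * (x - n%:R) - (4 * k)%:R by rewrite !hornerE.
have k0 : 0 < k%:R :> R by rewrite ltr0n.
have pn : p.[n%:R] < 0 by rewrite pE subrr mulr0 natrM; lra.
have pn1 : 0 <= p.[n%:R + 1].
  rewrite pE natrM; have : 2 * k%:R + 2 <= n%:R :> R by rewrite -natrM -natrD ler_nat.
  nra.
have nn1 : n%:R <= n%:R + 1 :> R by lra.
have [|a /andP[na _] /rootP pa] := @poly_ivt _ p _ _ nn1; first by rewrite (ltW pn).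
have {}na : n%:R < a.
  by rewrite lt_neqAle na andbT; apply: contraTneq pn => ->; rewrite pa ltxx.
rewrite pE -Gnk_cubic_factor in pa.
rewrite (Gnk_cubic_root R n k a) //; split=> //; split=> // y yP.
have [yn|ny] := lerP y n%:R; first by rewrite (le_trans yn) ?ltW.
by rewrite -(Gnk_cubic_root R n k a) // -(Gnk_cubic_root R n k y).
Qed.

(** * Common neighbours in $C_4$-free graphs, and counting of edges *)

Definition codeg {G : sgraph} (u v : G) : nat := #|[set w | u -- w & v -- w]|.

(** Otherwise $u, x, v, y$ in this cyclic order form a $C_4$. *)
Lemma C4_free_unique (G : sgraph) (u v x y : G) : C4_free G -> u != v ->
  u -- x -> v -- x -> u -- y -> v -- y -> x = y.
Proof.
move=> C4G uv ux vx uy vy; apply/eqP/negPn/negP => xy; case: C4G.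
have neq (a b : G) : a -- b -> a != b.
  by apply: contraTneq => ->; rewrite sedge_irrefl.
have s4 : uniq [:: u; x; v; y].
  by rewrite /= !inE !negb_or uv xy !neq // sedge_sym.
exists (fun i : C4 => nth u [:: u; x; v; y] i) => [i j /eqP|].
  by rewrite nth_uniq // => /eqP/val_inj.
by case=> [[|[|[|[|]]]]] // ? [[|[|[|[|]]]]] //= ? _; rewrite // sedge_sym.
Qed.

Lemma C4_free_codeg (G : sgraph) (u v : G) :
  C4_free G -> u != v -> (codeg u v <= 1)%N.
Proof.
move=> C4G uv; apply/card_le1_eqP => x y; rewrite !inE => /andP[ux vx] /andP[uy vy].
exact: (C4_free_unique G u v).
Qed.

(** One ordered pair per edge, so that edges are counted as pairs; the fixed orientation later also
    tells apart the two ends of a matching edge. *)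
Definition oriented_edges (G : sgraph) : {set G * G} :=
  [set p | p.1 -- p.2 & (enum_rank p.1 < enum_rank p.2)%N].

Lemma oriented_or (G : sgraph) (u v : G) : u -- v ->
  ((u, v) \in oriented_edges G) || ((v, u) \in oriented_edges G).
Proof.
move=> uv; rewrite !inE /= uv sedge_sym uv /=.
case: ltngtP => // /val_inj /enum_rank_inj uv'.
by rewrite uv' sedge_irrefl in uv.
Qed.

Lemma gsize_oriented (G : sgraph) : gsize G = #|oriented_edges G|.
Proof.
rewrite /gsize -(@card_in_imset _ _ (fun p : G * G => [set p.1; p.2])).
  apply: eq_card => e; apply/imsetP/imsetP => -[[u v] /= uv ->]; last first.
    by exists (u, v) => //; move: uv; rewrite !inE => /andP[].
  rewrite inE in uv; have /orP[] := oriented_or G u v uv; first by exists (u, v).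
  by exists (v, u) => //=; rewrite setUC.
move=> [u v] [u' v']; rewrite !inE /= => /andP[_ uv] /andP[_ uv'] /setP E.
move: (E u) (E v); rewrite !inE !eqxx orbT /=.
move=> /esym/orP[]/eqP uE /esym/orP[]/eqP vE; move: uv uv'; rewrite uE vE ?ltnn //.
by move=> /ltnW; rewrite leqNgt => /negbTE->.
Qed.

(** The ordered adjacent pairs are the disjoint union of the oriented edges and their reversals. *)
Lemma handshake (G : sgraph) : (\sum_(u : G) deg u = 2 * gsize G)%N.
Proof.
rewrite gsize_oriented mul2n -addnn.
pose swap (p : G * G) := (p.2, p.1).
have swapK : involutive swap by case.
rewrite -[X in (_ + X)%N](card_imset (oriented_edges G) (inv_inj swapK)).
rewrite -cardsUI [X in (_ + X)%N](_ : _ = 0%N) ?addn0; last first.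
  apply/eqP; rewrite cards_eq0; apply/eqP/setP => -[u v]; rewrite !inE /=.
  apply/negP => /andP[/andP[_ uv] /imsetP[[v' u']]].
  rewrite inE /= => /andP[_ vu] [uE vE].
  by subst; lia.
transitivity #|[set p : G * G | p.1 -- p.2]|.
  rewrite -sum1_card (eq_bigl (fun p : G * G => p.1 -- p.2)) => [|p]; last by rewrite inE.
  rewrite -(pair_big_dep xpredT (fun u v : G => u -- v) (fun _ _ => 1%N)) /=.
  by apply: eq_bigr => u _; rewrite sum1dep_card.
apply: eq_card => -[u v]; rewrite !inE /=.
have -> : ((u, v) \in swap @: oriented_edges G) = ((v, u) \in oriented_edges G).
  by rewrite -[(u, v)](swapK) (mem_imset _ _ (inv_inj swapK)).
apply/idP/idP => [/oriented_or|]; rewrite !inE //=.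
by case/orP => /andP[]; rewrite // sedge_sym.
Qed.

(** All vertices are kept and those outside [A] become isolated: degrees before and after live on
    the same type, and the added vertices contribute 0. *)
Definition restrict_rel (G : sgraph) (A : {set G}) : rel G :=
  fun u v => [&& u -- v, u \in A & v \in A].

Lemma restrict_sym (G : sgraph) (A : {set G}) : symmetric (restrict_rel G A).
Proof. by move=> u v; rewrite /restrict_rel sedge_sym [(u \in A) && _]andbC. Qed.

Lemma restrict_irrefl (G : sgraph) (A : {set G}) : irreflexive (restrict_rel G A).
Proof. by move=> u; rewrite /restrict_rel sedge_irrefl. Qed.

Definition restrict {G : sgraph} (A : {set G}) : sgraph :=
  SGraph (restrict_sym G A) (restrict_irrefl G A).

(** The sum is the degree sum of the graph induced on the neighbourhood of [v]. *)
Lemma nbr_codeg_even (G : sgraph) (v : G) : ~~ odd (\sum_(w | v -- w) codeg w v).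
Proof.
suff -> : (\sum_(w | v -- w) codeg w v = 2 * gsize (restrict [set w | v -- w]))%N.
  by rewrite mul2n odd_double.
rewrite -handshake big_mkcond; apply: eq_bigr => w _ /=.
case: ifP => vw.
  by apply: eq_card => z; rewrite !inE /= /restrict_rel !inE vw.
apply/esym/eqP; rewrite cards_eq0; apply/eqP/setP => z.
by rewrite !inE /= /restrict_rel !inE vw andbF.
Qed.

(** Both sides count the walks of length 2 from [v], by middle vertex and by end vertex. *)
Lemma sum_nbr_deg (G : sgraph) (v : G) :
  (\sum_(u | v -- u) deg u = \sum_(w : G) codeg w v)%N.
Proof.
under eq_bigr do rewrite /deg -sum1dep_card.
rewrite (exchange_big_dep xpredT) //=; apply: eq_bigr => w _.
rewrite /codeg -sum1dep_card; apply: eq_bigl => z.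
by rewrite [w -- z]sedge_sym andbC.
Qed.

Lemma codegvv (G : sgraph) (v : G) : codeg v v = deg v.
Proof. by apply: eq_card => w; rewrite !inE andbb. Qed.

Lemma deg_lt (G : sgraph) (v : G) : (deg v < #|G|)%N.
Proof.
rewrite -cardsT; apply: proper_card; rewrite properE subsetT /=.
by apply/subsetPn; exists v; rewrite !inE ?sedge_irrefl.
Qed.

Lemma nbr_codeg_le (G : sgraph) (v : G) : C4_free G ->
  (\sum_(w | v -- w) codeg w v <= deg v)%N.
Proof.
move=> C4G; rewrite /deg -sum1dep_card; apply: leq_sum => w vw.
by apply: C4_free_codeg => //; apply: contraTneq vw => ->; rewrite sedge_irrefl.
Qed.

(** In the sum of [codeg w v] over all [w], the term $w = v$ is $d(v)$, and each of the $|G| - 1 -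
    d(v)$ other non-neighbours contributes at most 1. *)
Lemma sum_nbr_deg_le (G : sgraph) (v : G) : C4_free G ->
  (\sum_(u | v -- u) deg u + 1 <= #|G| + \sum_(w | v -- w) codeg w v)%N.
Proof.
move=> C4G; rewrite sum_nbr_deg (bigID (fun w => v -- w)) /=.
rewrite [X in (_ + X + 1)%N](bigD1 v) ?sedge_irrefl //= codegvv.
have : (\sum_(w | ~~ v -- w && (w != v)) codeg w v + deg v + 1 <= #|G|)%N; last first.
  by move=> h; rewrite -addnA addnC leq_add2r [(deg v + _)%N]addnC.
have -> : #|G| = (\sum_(w | ~~ v -- w && (w != v)) 1 + deg v + 1)%N.
  rewrite -sum1_card (bigID (fun w => v -- w)) /=.
  rewrite [X in (_ + X)%N](bigD1 v) ?sedge_irrefl //=.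
  by rewrite sum1dep_card -/(deg v); lia.
by rewrite !leq_add2r; apply: leq_sum => w /andP[_ wv]; apply: C4_free_codeg.
Qed.

Lemma deg_gt0 (G : sgraph) (v : G) : gconnected G -> (1 < #|G|)%N -> (0 < deg v)%N.
Proof.
move=> conn G1; have /card_gt0P[w] : (0 < #|predC1 v|)%N by rewrite cardC1; lia.
rewrite !inE => wv; case/connectP: (conn v w) => -[/= _ E|x p /= /andP[vx _] _].
  by rewrite E eqxx in wv.
by apply/card_gt0P; exists x; rewrite inE.
Qed.

(** * Graphs without a dominating vertex *)

(** Let $d = d(u)$ and let $S$ be the sum of the codegrees of [u] with its neighbours. By
    [sum_nbr_deg_le] the degree certificate holds at [u] once $S \leq (d-1)(|G|-d-1)$. This is clear
    for $S < d$. As $S$ is even, $S = d$ forces $d \geq 2$ and, by the parity hypothesis, $|G| \geq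
    d + 3$. *)
Lemma signless_radius_le_degrees (R : realType) (G : sgraph) :
  gconnected G -> C4_free G -> (1 < #|G|)%N ->
  (forall v : G, deg v + 2 <= #|G|)%N ->
  (forall v : G, deg v + 2 = #|G| -> odd (deg v)) ->
  signless_radius R G <= #|G|%:R.
Proof.
move=> conn C4G G1 degG odd_deg.
apply: (signless_radius_le_nat R G (@deg G)); first by lia.
  by move=> u; apply: deg_gt0.
move=> u; rewrite big_split /= sum_nat_cond_const -/(deg u).
have := sum_nbr_deg_le G u C4G; have := nbr_codeg_le G u C4G.
have := nbr_codeg_even G u; have := odd_deg u; have := degG u; have := deg_gt0 G u conn G1.
set S := (\sum_(_ | _) codeg _ _)%N; set d := deg u; set T := (\sum_(_ | _) deg _)%N.
set m := #|G| => d0 dm dodd Seven Sd TS.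
have dS : (d = S -> d + 3 <= m)%N.
  move=> dS; have : d + 2 <> m by move=> /dodd; rewrite dS (negbTE Seven).
  lia.
have {}dS : (S + d + 3 <= m + d \/ S + 1 <= d)%N by lia.
nia.
Qed.

Lemma sum_common_nbr_le (G : sgraph) (u v : G) (F : G -> nat) (b : nat) :
  C4_free G -> u != v -> (forall w, u -- w -> v -- w -> F w <= b)%N ->
  (\sum_(w | u -- w && v -- w) F w <= b)%N.
Proof.
move=> C4G uv Fb; apply: (@leq_trans (codeg u v * b)).
  by rewrite -sum_nat_cond_const; apply: leq_sum => w /andP[]; apply: Fb.
by rewrite -[leqRHS]mul1n leq_mul2r C4_free_codeg ?orbT.
Qed.

(* With w the only non-neighbour of c and t the neighbour of w, the certificate
   is n - 3 at c, 1 at w, 2 at t and at the common neighbour of c and t, and 1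
   elsewhere. *)
Lemma signless_radius_le_near_dominating (R : realType) (G : sgraph) (c : G) :
  gconnected G -> C4_free G -> (6 <= #|G|)%N -> (deg c + 2)%N = #|G| ->
  signless_radius R G <= #|G|%:R.
Proof.
move=> conn C4G G6 cdeg; set n := #|G| in G6 cdeg *.
have neq (a b : G) : a -- b -> a != b.
  by apply: contraTneq => ->; rewrite sedge_irrefl.
have [w wP] : exists w, [set w] = ~: (c |: [set v | c -- v]).
  suff /eqP/cards1P[w ->] : #|~: (c |: [set v | c -- v])| = 1%N by exists w.
  have := cardsC (c |: [set v | c -- v]).
  by rewrite cardsU1 inE sedge_irrefl -/(deg c) -/n; lia.
have wE v : (v == w) = (v != c) && ~~ c -- v.
  by move/setP/(_ v): wP; rewrite !inE negb_or.
have /andP[wc cw] : (w != c) && ~~ c -- w by rewrite -wE.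
have [t wt] : exists t, w -- t.
  have /card_gt0P[t] : (0 < deg w)%N by apply: deg_gt0 => //; rewrite -/n; lia.
  by rewrite inE; exists t.
have nbr_w v : w -- v -> c -- v.
  move=> wv; have := wE v; rewrite eq_sym (negbTE (neq w v wv)).
  have -> : v != c by apply: contraNneq cw => <-; rewrite sedge_sym.
  by move/esym/negbFE.
have ct := nbr_w t wt.
(* All neighbours of [w] are common neighbours of [w] and [c], so there is only one. *)
have wtE v : w -- v -> v = t.
  by move=> wv; apply: (C4_free_unique G w c) => //; apply: nbr_w.
pose x v := (if v == c then n - 3 else if v == w then 1 else 1 + (v == t) + (t -- v))%N.
have xc : x c = (n - 3)%N by rewrite /x eqxx.
have xw : x w = 1%N by rewrite /x eqxx (negbTE wc).
have xN v : c -- v -> x v = (1 + (v == t) + (t -- v))%N.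
  move=> cv; rewrite /x eq_sym (negbTE (neq c v cv)); case: eqP => // vw.
  by rewrite -vw cv in cw.
have xN2 v : c -- v -> (x v <= 2)%N.
  move=> cv; rewrite xN //; case: eqP => [->|_]; first by rewrite sedge_irrefl.
  by case: (t -- v).
apply: (signless_radius_le_nat R G x) => [|v|u]; first by rewrite -/n; lia.
  by rewrite /x; case: ifP => _; [lia | case: ifP].
have [->{u}|uc] := eqVneq u c.
  (* The excess over 1 comes from [t] and from the at most one common neighbour of [c] and [t]. The
     inequality at [c] becomes $(n-2)(n-3) + n \leq n(n-3)$, that is $n \geq 6$. *)
  have : (\sum_(v | c -- v) x v <= deg c + 2)%N.
    rewrite (eq_bigr (fun v => (1 + (v == t)) + (t -- v))%N) => [|v]; last exact: xN.
    rewrite !big_split /= sum1dep_card -/(deg c) -addnA leq_add2l.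
    apply: (@leq_add _ _ 1 1).
      by rewrite (bigD1 t) //= eqxx big1 // => v /andP[_ /negbTE->].
    rewrite -big_mkcondr /=.
    by apply: (sum_common_nbr_le G c t) => //; apply: neq.
  rewrite big_split /= sum_nat_cond_const -/(deg c) xc; set S := (\sum_(_ | _) _)%N; nia.
have [->{u uc}|uw] := eqVneq u w.
  rewrite (big_pred1 t) => [|v]; last by apply/idP/eqP => [/wtE|->].
  by rewrite xw xN // eqxx sedge_irrefl; lia.
have cu : c -- u by have := wE u; rewrite (negbTE uw) uc => /esym/negbFE.
(* A neighbour [u] of [c] is adjacent to [c], possibly to [w], and to at most one further vertex, a
   common neighbour with [c]. *)
have sum_u (F : G -> nat) :
    (\sum_(v | u -- v) F v = F c + (u -- w) * F w + \sum_(v | u -- v && c -- v) F v)%N.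
  rewrite (bigD1 c) /=; last by rewrite sedge_sym.
  rewrite (bigID (fun v => c -- v)) /= addnCA addnC; congr (_ + _ + _)%N; last first.
    apply: eq_bigl => v; rewrite -andbA; congr (_ && _).
    by case: eqP => // ->; rewrite sedge_irrefl.
  rewrite (eq_bigl (fun v => (v == w) && (u -- w))) => [|v].
    by rewrite big_mkcondr big_pred1_eq; case: (u -- w); rewrite ?mul1n.
  by rewrite -andbA -wE andbC; case: eqP => // ->.
rewrite sum_u xw xc.
have uwE : u -- w = (u == t).
  by apply/idP/eqP => [|->]; rewrite sedge_sym // => /wtE.
have bnd : (x u <= 2)%N := xN2 u cu.
have [ut|ut] := eqVneq u t.
  have : (\sum_(v | u -- v && c -- v) (x u + x v) <= 4)%N.
    apply: sum_common_nbr_le; rewrite // 1?eq_sym ?neq // => v uv cv.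
    exact: leq_add bnd (xN2 v cv).
  by rewrite uwE ut eqxx xN // eqxx sedge_irrefl; clear -G6; lia.
rewrite uwE (negbTE ut) mul0n addn0.
case tu: (t -- u).
  have : (\sum_(v | u -- v && c -- v) (x u + x v) <= 4)%N.
    apply: sum_common_nbr_le; rewrite // 1?eq_sym ?neq // => v uv cv.
    exact: leq_add bnd (xN2 v cv).
  by rewrite xN // tu (negbTE ut); clear -G6; lia.
(* Here [u] has value 1 and the edge to [c] uses $n - 2$ of the allowed $n$, so the remaining
   neighbour must have value 1. *)
have : (\sum_(v | u -- v && c -- v) (x u + x v) <= 2)%N.
  apply: sum_common_nbr_le; rewrite // 1?eq_sym ?neq // => v uv cv.
  rewrite !xN // tu (negbTE ut); have -> : v == t = false.
    by apply: contraFF tu => /eqP <-; rewrite sedge_sym.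
  suff -> : t -- v = false by [].
  (* If [t] were adjacent to [v], then [t] and [u] would both be common neighbours of [c] and
     [v]. *)
  apply: contra_neqF ut => tv.
  by apply: (C4_free_unique G c v) => //; rewrite ?neq // sedge_sym.
by rewrite xN // tu (negbTE ut); clear -G6; lia.
Qed.

Lemma signless_radius_le_max_degree (R : realType) (G : sgraph) (m : nat) :
  (0 < #|G|)%N -> (forall v : G, 2 * deg v <= m)%N -> signless_radius R G <= m%:R.
Proof.
move=> G0 degm; apply: (signless_radius_le_nat R G (fun=> 1%N)) => // u.
by rewrite sum_nat_cond_const muln1 mulnC; apply: degm.
Qed.

Lemma signless_radius_le_order (R : realType) (G : sgraph) :
  gconnected G -> C4_free G -> (4 <= #|G|)%N ->
  (forall v : G, deg v + 2 <= #|G|)%N ->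
  signless_radius R G <= #|G|%:R.
Proof.
move=> conn C4G G4 degG.
have [G6|G6] := leqP 6 #|G|.
  have [/existsP[c /eqP]|] := boolP [exists c : G, deg c + 2 == #|G|]%N.
    exact: signless_radius_le_near_dominating.
  move=> /existsPn noc; apply: signless_radius_le_degrees => // [|v /eqP]; first by lia.
  by rewrite (negbTE (noc v)).
(* For order 4 all degrees are at most 2. For order 5 the degree $n - 2 = 3$ is odd, so the degree
   certificate applies. *)
have [G4'|G5] := eqVneq #|G| 4.
  apply: signless_radius_le_max_degree => [|v]; first by lia.
  by have := degG v; lia.
by apply: signless_radius_le_degrees => // [|v]; lia.
Qed.

(** * Graphs with a dominating vertex *)

Lemma dominating_nbr (G : sgraph) (c u : G) :
  (deg c + 1)%N = #|G| -> c -- u = (u != c).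
Proof.
move=> cdeg; suff /setP/(_ u) : [set v | c -- v] = [set~ c] by rewrite !inE.
apply/eqP; rewrite eqEcard cardsC1 -cdeg addn1 leqnn andbT.
by apply/subsetP => v; rewrite !inE; apply: contraTneq => ->; rewrite sedge_irrefl.
Qed.

(** Compared through degree sums: deleting the edges at [c] lowers every other degree by exactly
    1. *)
Lemma gsize_dominating (G : sgraph) (c : G) : (deg c + 1)%N = #|G| ->
  gsize G = (deg c + gsize (restrict [set~ c]))%N.
Proof.
move=> cdeg; have cE u := dominating_nbr G c u cdeg.
set H := restrict [set~ c].
suff : (2 * gsize G = 2 * (deg c + gsize H))%N by lia.
rewrite mulnDr -!handshake [LHS](bigD1 c) // [in RHS](bigD1 c) //=.
have -> : @deg H c = 0%N.
  apply/eqP; rewrite cards_eq0; apply/eqP/setP => u.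
  by rewrite !inE /= /restrict_rel !inE eqxx andbF.
rewrite add0n mul2n -addnn -addnA; congr (_ + _)%N.
rewrite (eq_bigr (fun u => 1 + @deg H u)%N) => [|u uc].
  rewrite big_split /= sum1_card cardC1; congr (_ + _)%N.
  by rewrite -cdeg addn1.
rewrite /deg (cardsD1 c) inE sedge_sym cE uc; congr (_ + _)%N.
by apply: eq_card => v; rewrite !inE /= /restrict_rel !inE uc andbC.
Qed.

(** The isomorphism is built from $G_n^k$ to $G$: the centre goes to [c], the other vertices of the
    $i$-th triangle to the ends of the $i$-th edge avoiding [c], and the pendant vertices to an
    enumeration of what is left. *)
Lemma dominating_isomorphic (G : sgraph) (k : nat) (c : G) :
  C4_free G -> (deg c + 1)%N = #|G| -> (gsize G + 1 = #|G| + k)%N ->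
  isomorphic G (Gnk #|G| k).
Proof.
move=> C4G cdeg Gsize; have cE u := dominating_nbr G c u cdeg.
pose P := oriented_edges (restrict [set~ c]).
(* Replacing [k] by the cardinal of [P] lets [enum_val] index the triangles by the edges. *)
have <- : #|P| = k.
  by rewrite -gsize_oriented; have := gsize_dominating G c cdeg; lia.
pose V := ('I_#|P| * 'I_2)%type.
pose h (x : V) : G := if x.2 == ord0 then (enum_val x.1).1 else (enum_val x.1).2.
pose mate (x : V) : V := (x.1, rev_ord x.2).
have PE (i : 'I_#|P|) : [/\ @sedge G (enum_val i).1 (enum_val i).2,
    (enum_val i).1 != c :> G, (enum_val i).2 != c :> G &
    (enum_rank ((enum_val i).1 : G) < enum_rank ((enum_val i).2 : G))%N].
  have := enum_valP i; rewrite inE /= /restrict_rel !inE.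
  by move=> /andP[/and3P[-> -> ->] ->].
have hc x : h x != c by rewrite /h; case: (PE x.1) => _ ? ? _; case: ifP.
have h_mate x : h x -- h (mate x).
  case: x => i a; case: (PE i) => e _ _ _.
  by case: a => [[|[|]]] // a; rewrite sedge_sym.
have mateP u v : u -- v -> u != c -> v != c -> exists2 x, u = h x & v = h (mate x).
  move=> uv uc vc; have uvH : @sedge (restrict [set~ c]) u v.
    by rewrite /= /restrict_rel !inE uv uc.
  have /orP[uvP|vuP] := oriented_or _ _ _ uvH.
    by exists (enum_rank_in uvP (u, v), ord0); rewrite /h /= enum_rankK_in.
  by exists (enum_rank_in vuP (v, u), ord_max); rewrite /h /= enum_rankK_in.
(* Two such neighbours of [u] would both be common neighbours of [u] and [c]; so the edges avoiding
   [c] form a matching. *)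
have unique u v v' : u -- v -> u -- v' -> u != c -> v != c -> v' != c -> v = v'.
  move=> uv uv' uc vc v'c.
  by apply: (C4_free_unique G c u); rewrite ?cE // eq_sym.
have h_inj : injective h.
  move=> x y xy; have xy' : h (mate x) = h (mate y).
    by apply: (unique (h x)) => //; rewrite xy.
  (* Equal ends have equal mates, so the two edges coincide up to orientation. Ends in opposite
     positions would make one the reversal of the other, against the order of ranks. *)
  case: x y xy xy' => [i [[|[|]] // a]] [j [[|[|]] // b]]; rewrite /h /mate /= => e e'.
  - congr (_, _); last exact: val_inj.
    by apply: enum_val_inj; apply: injective_projections.
  - have [_ _ _] := PE i; have [_ _ _] := PE j; rewrite e e' => /ltnW.
    by rewrite leqNgt => /negbTE->.
  - have [_ _ _] := PE i; have [_ _ _] := PE j; rewrite e e' => /ltnW.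
    by rewrite leqNgt => /negbTE->.
  congr (_, _); last exact: val_inj.
  by apply: enum_val_inj; apply: injective_projections.
have h_adj x y : h x -- h y = (y == mate x).
  apply/idP/eqP => [xy|->]; last exact: h_mate.
  by apply: h_inj; apply: (unique (h x)).
(* The vertices missed by the matching: their only neighbour is [c]. *)
pose B := ~: (c |: h @: setT).
have Bcard : (#|B| + 2 * #|P| + 1)%N = #|G|.
  rewrite -(cardsC (c |: h @: setT)) cardsU1 card_imset // cardsT card_prod !card_ord.
  have -> : c \notin h @: setT.
    by apply/imsetP => -[x _ /esym/eqP]; apply/negP.
  by rewrite -/B /=; lia.
have BE u : u \in B -> u != c /\ forall x, u != h x.
  rewrite !inE negb_or => /andP[-> /imsetP uh]; split=> // x.
  by apply: contra_notN uh => /eqP ->; exists x.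
have B_adj u v : u \in B -> v != c -> u -- v = false.
  move=> /BE[uc uh] vc; apply/negP => uv.
  by have [x ux _] := mateP u v uv uc vc; have := uh x; rewrite ux eqxx.
have mE : (#|G| - 2 * #|P| - 1)%N = #|B| by lia.
pose f (x : Gnk #|G| #|P|) : G := match x with
  | inl _ => c
  | inr (inl y) => h y
  | inr (inr y) => enum_val (cast_ord mE y.1)
  end.
have fB j : enum_val (cast_ord mE j) \in B by apply: enum_valP.
apply: isomorphic_sym; exists f.
  apply: inj_card_bij.
    move=> [x|[x|[x e]]] [y|[y|[y e']]] //=.
    - by rewrite (ord1 x) (ord1 y).
    - by move/esym/eqP; rewrite (negbTE (hc y)).
    - by move/esym/eqP; rewrite (negbTE (BE _ (fB y)).1).
    - by move/eqP; rewrite (negbTE (hc x)).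
    - by move/h_inj ->.
    - by move/esym/eqP; rewrite (negbTE ((BE _ (fB y)).2 x)).
    - by move/eqP; rewrite (negbTE (BE _ (fB x)).1).
    - by move/eqP; rewrite (negbTE ((BE _ (fB x)).2 y)).
    by move/enum_val_inj/cast_ord_inj ->; rewrite (ord1 e) (ord1 e').
  rewrite !card_sum !card_prod !card_ord; lia.
move=> [x|[x|[x e]]] [y|[y|[y e']]] /=.
- by rewrite sedge_irrefl /complete_rel (ord1 x) (ord1 y) eqxx.
- by rewrite cE hc.
- by rewrite cE (BE _ (fB y)).1.
- by rewrite sedge_sym cE hc.
- rewrite h_adj /mate /copies_rel /= /complete_rel; case: x y => [i a] [j b] /=.
  rewrite xpair_eqE eq_sym; congr (_ && _).
  by case: a b => [[|[|]] // ?] [[|[|]] // ?].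
- by rewrite sedge_sym B_adj.
- by rewrite sedge_sym cE (BE _ (fB x)).1.
- by rewrite B_adj.
by rewrite B_adj ?(BE _ (fB y)).1 // /copies_rel /= /complete_rel (ord1 e) (ord1 e') andbF.
Qed.

Theorem theorem3p1 (R : realType) (k n : nat)
    (hk : (1 <= k)%N) (hn : (2 * k + 2 <= n)%N) :
  (forall G : sgraph, gorder G = n -> cyclic_graph k G -> C4_free G ->
     signless_radius R G <= signless_radius R (Gnk n k) /\
     (signless_radius R G = signless_radius R (Gnk n k) <->
        isomorphic G (Gnk n k)))
  /\ largest
       (fun x : R => x ^+ 3 - (n + 3)%:R * x ^+ 2 + (3 * n)%:R * x
                     - (4 * k)%:R = 0)
       (signless_radius R (Gnk n k)).
Proof.
have [nq qroot] := Gnk_radius R n k hk hn; split=> // G Gn [conn Gsize] C4G.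
have Gcard : #|G| = n := Gn.
have G0 : (0 < #|G|)%N by lia.
have [/existsP[c /eqP cdeg]|/existsPn noc] := boolP [exists c : G, deg c + 1 == #|G|]%N.
  have iso : isomorphic G (Gnk n k).
    by rewrite -Gcard; apply: dominating_isomorphic cdeg Gsize.
  by have E := isomorphic_signless_radius R G _ G0 iso; split; [rewrite E | split].
(* Without a dominating vertex the inequality is strict, so both sides of the equivalence fail: an
   isomorphism would force equal radii. *)
have lt : signless_radius R G < signless_radius R (Gnk n k).
  apply: le_lt_trans nq; rewrite -Gcard; apply: signless_radius_le_order => //; first by lia.
  by move=> v; have := noc v; have := deg_lt G v; lia.
split; first exact: ltW.
split=> [E|/(isomorphic_signless_radius R G _ G0) E]; by rewrite E ltxx in lt.
Qed.
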